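(* Let $\lambda\in\mathbb{C}$ and let $m,n\ge0$ be integers. Then \[ (m+n)_\lambda!=\sum_{j=0}^m{m \brack j}_\lambda\langle 1+m\lambda\rangle_{n,\lambda}=\sum_{j=0}^m\sum_{k=0}^n{m \brack j}_\lambda\binom{n}{k}\langle m\lambda\rangle_{n-k,\lambda}\langle 1\rangle_{k,\lambda}. \]
   Context: For $\lambda\in\mathbb{C}$, the $\lambda$-rising factorial is $\langle x\rangle_{0,\lambda}=1$, $\langle x\rangle_{n,\lambda}=x(x+\lambda)\cdots(x+(n-1)\lambda)$ for $n\ge1$. The unsigned $\lambda$-Stirling numbers of the first kind are defined by $\langle x\rangle_{n,\lambda}=\sum_{k=0}^n {n \brack k}_\lambda x^k$. The $\lambda$-factorial is $(0)_\lambda!=1$ and $(n)_\lambda!=\langle 1\rangle_{n,\lambda}=\sum_{k=0}^n{n \brack k}_\lambda$ for $n\ge1$. *)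

(* Defs.v *)
From mathcomp Require Import all_boot all_order all_algebra.
From mathcomp Require Import reals complex.
Set Implicit Arguments.
Unset Strict Implicit.
Unset Printing Implicit Defensive.
Import GRing.Theory.
Local Open Scope ring_scope.

Definition lrising (A : comNzRingType) (lambda x : A) (n : nat) : A :=
  \prod_(i < n) (x + i%:R * lambda).

(* The numbers defined by <x>_{n,lambda} = sum_k [n, k]_lambda x^k are the
   coefficients of the rising factorial of the indeterminate, taken in
   {poly A}; see [lrising_stirling]. *)
Definition lstirling1 (A : comNzRingType) (lambda : A) (n k : nat) : A :=
  (lrising lambda%:P 'X n)`_k.

Definition lfactorial (A : comNzRingType) (lambda : A) (n : nat) : A :=
  lrising lambda 1 n.

Lemma size_lrisingX (A : comNzRingType) (lambda : A) (n : nat) :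
  size (lrising lambda%:P 'X n) = n.+1.
Proof.
rewrite /lrising (eq_bigr (fun i : 'I_n => 'X - (- (i%:R * lambda))%:P)).
  rewrite -(big_map (fun i : 'I_n => - (i%:R * lambda)) xpredT
    (fun c => 'X - c%:P)) size_prod_XsubC size_map.
  by rewrite /index_enum -enumT size_enum_ord.
by move=> i _; rewrite polyCN opprK polyCM polyC_natr.
Qed.

Lemma lrising_stirling (A : comNzRingType) (lambda x : A) (n : nat) :
  lrising lambda x n = \sum_(k < n.+1) lstirling1 lambda n k * x ^+ k.
Proof.
rewrite /lstirling1 -(size_lrisingX lambda n) -horner_coef horner_prod.
by apply: eq_bigr => i _; rewrite !hornerE -polyC_natr !hornerE.
Qed.

Lemma lfactorial_stirling (A : comNzRingType) (lambda : A) (n : nat) :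
  lfactorial lambda n = \sum_(k < n.+1) lstirling1 lambda n k.
Proof.
rewrite /lfactorial lrising_stirling.
by apply: eq_bigr => k _; rewrite expr1n mulr1.
Qed.

(* Main.v *)
Require Import Defs.
From mathcomp Require Import all_boot all_order all_algebra.
From mathcomp Require Import reals complex.
From mathcomp Require Import ring.
Import GRing.Theory.
Local Open Scope ring_scope.

(** Cutting the product $\langle 1\rangle_{m+n,\lambda}$ after its first $m$ factors leaves a rising
    factorial restarted at $1+m\lambda$ ([lrising_addn]); the first block is $(m)_\lambda!$, the sum
    of the Stirling numbers. The second equality holds for each $j$ separately: rising factorials
    are of binomial type ([lrising_addr]), applied to $m\lambda+1$. *)

Lemma lrising0 (A : comNzRingType) (lambda x : A) : lrising lambda x 0 = 1.
Proof. by rewrite /lrising big_ord0. Qed.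

Lemma lrisingS (A : comNzRingType) (lambda x : A) (n : nat) :
  lrising lambda x n.+1 = lrising lambda x n * (x + n%:R * lambda).
Proof. by rewrite /lrising big_ord_recr. Qed.

Lemma lrising_addn (A : comNzRingType) (lambda x : A) (m n : nat) :
  lrising lambda x (m + n) =
    lrising lambda x m * lrising lambda (x + m%:R * lambda) n.
Proof.
elim: n => [|n IHn]; first by rewrite addn0 lrising0 mulr1.
by rewrite addnS !lrisingS IHn natrD mulrDl addrA mulrA.
Qed.

(** A Vandermonde identity, by induction on $n$: in the $k$-th term the new factor splits as
    $x+y+n\lambda=(x+(n-k)\lambda)+(y+k\lambda)$, each half extending one of the two rising
    factorials; Pascal's rule recombines them. *)
Lemma lrising_addr (A : comNzRingType) (lambda x y : A) (n : nat) :
  lrising lambda (x + y) n =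
    \sum_(k < n.+1) 'C(n, k)%:R * lrising lambda x (n - k) * lrising lambda y k.
Proof.
elim: n => [|n IHn].
  by rewrite big_ord_recl big_ord0 bin0 !lrising0 !mulr1 addr0.
have split_factor (k : 'I_n.+1) :
    'C(n, k)%:R * lrising lambda x (n - k) * lrising lambda y k
      * (x + y + n%:R * lambda) =
    'C(n, k)%:R * lrising lambda x (n.+1 - k) * lrising lambda y k
    + 'C(n, k)%:R * lrising lambda x (n - k) * lrising lambda y k.+1.
  have lekn : (k <= n)%N by rewrite -ltnS.
  rewrite subSn // !lrisingS.
  have -> : n%:R = (n - k)%:R + k%:R :> A by rewrite -natrD subnK.
  by ring.
rewrite lrisingS IHn mulr_suml (eq_bigr _ (fun k _ => split_factor k)) big_split.
(* Peeling off $k=0$ leaves indices of the form [k.+1], to which Pascal's rule applies. *)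
rewrite [RHS]big_ord_recl /=.
under [X in _ = _ + X]eq_bigr => k _ do
  rewrite /bump /= add1n binS natrD subSS !mulrDl.
rewrite big_split /= addrA; congr (_ + _).
(* The extra term $k=n+1$ vanishes because ['C(n, n.+1)] is zero; with it the range matches the
   peeled term plus the ['C(n, k.+1)] half. *)
transitivity (\sum_(k < n.+2)
    'C(n, k)%:R * lrising lambda x (n.+1 - k) * lrising lambda y k).
  by rewrite [RHS]big_ord_recr /= bin_small // !mul0r addr0.
by rewrite big_ord_recl /= !bin0.
Qed.

Theorem theorem7 (R : realType) (lambda : R[i]) (m n : nat) :
  lfactorial lambda (m + n) =
    \sum_(j < m.+1)
      lstirling1 lambda m j * lrising lambda (1 + m%:R * lambda) n
  /\
  \sum_(j < m.+1)
      lstirling1 lambda m j * lrising lambda (1 + m%:R * lambda) n =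
    \sum_(j < m.+1) \sum_(k < n.+1)
      lstirling1 lambda m j * 'C(n, k)%:R
      * lrising lambda (m%:R * lambda) (n - k) * lrising lambda 1 k.
Proof.
split.
  by rewrite -mulr_suml -lfactorial_stirling /lfactorial lrising_addn.
(* The swap gives $m\lambda$ the index $n-k$ and $1$ the index $k$. *)
apply: eq_bigr => j _; rewrite addrC lrising_addr mulr_sumr.
by apply: eq_bigr => k _; rewrite !mulrA.
Qed.
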